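(* Assume that $J$ is Lasry--Lions monotone, i.e. $\langle J(\mu,\cdot)-J(\nu,\cdot),\mu-\nu\rangle\ge 0$ for all $\mu,\nu\in\mathcal P(\Omega)$; that there is $L_m>0$ with $\|J(\mu,\cdot)-J(\nu,\cdot)\|_\infty\le L_mW_1(\mu,\nu)$ for all $\mu,\nu\in\mathcal P(\Omega)$; and that there is $L_x>0$ with $|J(\rho,x)-J(\rho,y)|\le L_x|x-y|$ for all $\rho\in\mathcal P(\Omega)$ and $x,y\in\Omega$. Let $(X_h)_{h>0}$ be a family of finite subsets of $\Omega$ and, for each $h>0$, let $Q_h:\Omega\to X_h$ be a measurable map with $\sup_{x\in\Omega}|Q_h(x)-x|\le h$. For each $h>0$ let $\mu_{0,h}\in\mathcal P(X_h)$ satisfy $\mu_{0,h}(\{x\})>0$ for all $x\in X_h$, and set $m_h:=\min_{x\in X_h}\mu_{0,h}(\{x\})$. Let $0<\lambda<\frac{1}{L_mD_\Omega}$ and, for each $h$, let $(\mu_{k,h},\nu_{k,h})_{k\ge0}$ be the KL Mirror-Prox iterates with stepsize $\lambda$ initialized from $\mu_{0,h}$. For $h>0$ and $K\ge1$ define $\bar\nu_{K,h}:=\frac1K\sum_{k=0}^{K-1}\nu_{k,h}$. Then $$\bigl\langle J(\eta,\cdot),\eta-\bar\nu_{K,h}\bigr\rangle\ge-\varepsilon_{K,h}\qquad\forall\,\eta\in\mathcal P(\Omega),$$ where $$\varepsilon_{K,h}:=\frac{\log(1/m_h)}{\lambda K}+(2L_m+L_x)h.$$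
   Context: $\Omega\subset\mathbb R^d$ is a nonempty compact set, $D_\Omega:=\sup_{x,y\in\Omega}|x-y|$, and $\mathcal P(\Omega)$ is the set of Borel probability measures on $\Omega$. $J:\mathcal P(\Omega)\times\Omega\to\mathbb R$ is such that $J(\mu,\cdot)\in C(\Omega)$ for every $\mu\in\mathcal P(\Omega)$. For $f\in C(\Omega)$ and a finite signed measure $\xi$, $\langle f,\xi\rangle:=\int_\Omega f\,d\xi$. $W_1$ is the 1-Wasserstein distance on $\mathcal P(\Omega)$ for the Euclidean distance. For $X_h\subset\Omega$, $\mathcal P(X_h)$ is identified with the set of measures in $\mathcal P(\Omega)$ supported on $X_h$. KL Mirror-Prox iterates with stepsize $\lambda>0$ initialized from a probability measure $\mu_0$: for $k=0,1,2,\dots$, $$\nu_k(dx)=\frac{e^{-\lambda J(\mu_k,x)}\mu_k(dx)}{\int_\Omega e^{-\lambda J(\mu_k,z)}\mu_k(dz)},\qquad \mu_{k+1}(dx)=\frac{e^{-\lambda J(\nu_k,x)}\mu_k(dx)}{\int_\Omega e^{-\lambda J(\nu_k,z)}\mu_k(dz)}.$$ When $\mu_0=\mu_{0,h}$ is supported on the finite set $X_h$, all iterates are measures on $X_h$ (the integrals are finite sums). *)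

(* Defs.v *)
From HB Require Import structures.
From mathcomp Require Import all_boot all_order all_algebra.
From mathcomp Require Import all_classical all_reals all_analysis.

Set Implicit Arguments.
Unset Strict Implicit.
Unset Printing Implicit Defensive.

Import Order.TTheory GRing.Theory Num.Theory.
Import numFieldNormedType.Exports.

Local Open Scope classical_set_scope.
Local Open Scope ring_scope.

(* R^d with its Borel sigma-algebra; the sup norm carried by 'rV[R]_d generates
   the usual Euclidean topology. *)
Definition borel_rV (R : realType) (d : nat) :=
  g_sigma_algebraType (@open 'rV[R]_d).

Definition eucl_dist (R : realType) (d : nat) (x y : 'rV[R]_d) : R :=
  Num.sqrt (\sum_(i < d) (x 0 i - y 0 i) ^+ 2).

(* Meaningful for nonempty bounded sets, on which [sup] is the supremum. *)
Definition diameter (R : realType) (d : nat) (Omega : set 'rV[R]_d) : R :=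
  sup [set eucl_dist z.1 z.2 | z in Omega `*` Omega].

Definition sup_norm (R : realType) (d : nat) (Omega : set 'rV[R]_d)
    (f : 'rV[R]_d -> R) : \bar R :=
  ereal_sup [set `|f x|%:E | x in Omega].

(* For a Borel set X, the probability measures on X are identified with the
   Borel probability measures on R^d giving full mass to X. *)
Definition prob_on (R : realType) (d : nat) (X : set 'rV[R]_d)
    (mu : probability (borel_rV R d) R) : Prop :=
  mu X = 1%E.

(* < f , mu - nu > over Omega; for finite mu and nu and f bounded measurable on
   Omega this is the integral of f against the signed measure mu - nu. *)
Definition pairing_sub (R : realType) (d : nat) (Omega : set 'rV[R]_d)
    (f : 'rV[R]_d -> R) (mu nu : {measure set (borel_rV R d) -> \bar R}) : R :=
  \int[mu]_(x in Omega) f x - \int[nu]_(x in Omega) f x.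

Definition coupling (R : realType) (d : nat)
    (mu nu : probability (borel_rV R d) R)
    (pi : probability (borel_rV R d * borel_rV R d)%type R) : Prop :=
  forall A : set (borel_rV R d), measurable A ->
    pi (fst @^-1` A) = mu A /\ pi (snd @^-1` A) = nu A.

Definition W1 (R : realType) (d : nat)
    (mu nu : probability (borel_rV R d) R) : \bar R :=
  ereal_inf [set (\int[pi]_z (eucl_dist z.1 z.2)%:E)%E
            | pi in [set pi | coupling mu nu pi]].

(* nu(dx) = exp(- lambda V(x)) mu(dx) / \int_Omega exp(- lambda V) dmu. *)
Definition gibbs_step (R : realType) (d : nat) (Omega : set 'rV[R]_d)
    (lambda : R) (V : 'rV[R]_d -> R)
    (mu nu : probability (borel_rV R d) R) : Prop :=
  forall A : set (borel_rV R d), measurable A ->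
    nu A = ((\int[mu]_(x in A `&` Omega) expR (- lambda * V x)) /
            (\int[mu]_(x in Omega) expR (- lambda * V x)))%:E.

Definition KL_mirror_prox (R : realType) (d : nat) (Omega : set 'rV[R]_d)
    (J : probability (borel_rV R d) R -> 'rV[R]_d -> R) (lambda : R)
    (mu0 : probability (borel_rV R d) R)
    (mu nu : nat -> probability (borel_rV R d) R) : Prop :=
  mu 0%N = mu0 /\
  forall k, gibbs_step Omega lambda (J (mu k)) (mu k) (nu k) /\
            gibbs_step Omega lambda (J (nu k)) (mu k) (mu k.+1).

(* K^-1 * (nu_0 + ... + nu_(K-1)), a probability measure when 0 < K. *)
Definition average (R : realType) (d : nat)
    (nu : nat -> probability (borel_rV R d) R) (K : nat) :
    {measure set (borel_rV R d) -> \bar R} :=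
  mscale (K%:R^-1 : R)%:nng (msum (fun k => nu k) K).

(* The minimum of mu{x} over x in X; the infimum is attained when X is finite
   and nonempty. *)
Definition min_mass (R : realType) (d : nat) (X : set 'rV[R]_d)
    (mu : probability (borel_rV R d) R) : R :=
  inf [set fine (mu [set x]) | x in X].

(* Main.v *)
Require Import Defs.
From HB Require Import structures.
From mathcomp Require Import all_boot all_order all_algebra.
From mathcomp Require Import all_classical all_reals all_analysis.
From mathcomp Require Import measurable_realfun ring lra.

Set Implicit Arguments.
Unset Strict Implicit.
Unset Printing Implicit Defensive.

Import Order.TTheory GRing.Theory Num.Theory.
Import numFieldNormedType.Exports.

Local Open Scope classical_set_scope.
Local Open Scope ring_scope.

(** The iterates live on the finite grid [X h], so everything reduces to finite
    sums over its points [e i]; write [p_k], [q_k] for the weights of [mu_k],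
    [nu_k] there.

    One step.  Taking logarithms in the two multiplicative updates expresses
    [lambda * J (mu k)] and [lambda * J (nu k)], up to additive constants, as
    differences of log-weights.  For every weight vector [w] of mass 1 this
    gives
      [lambda * <J(nu_k), q_k - w>
         = lambda * <J(nu_k) - J(mu_k), q_k - p_(k+1)>
           - KL(q_k|p_k) - KL(p_(k+1)|q_k) + <w, ln p_(k+1) - ln p_k>].
    The first term on the right is absorbed by the two divergences
    ([mirror_prox_descent]).  Indeed [J] is [Lm]-Lipschitz for [W1]; the maximal
    coupling gives [W1 <= D / 2 * l1], with [D] the diameter
    ([W1_le_diam_l1]); and [l1 ^ 2 <= 4 KL] ([sqr_l1_le_kl]), a form of
    Pinsker's inequality which passes through the Hellinger distance and
    suffices because [lambda * Lm * D <= 1].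

    Many steps.  The last term telescopes, its total is at most
    [ln (1 / min_mass)] ([mirror_prox_regret]).

    Comparison with an arbitrary [eta].  Monotonicity applied to the pair
    [(eta, nu_k)] bounds [<J(eta), nu_k - eta>] by [<J(nu_k), nu_k - eta>].  In
    the latter, [eta] is replaced by its image [w] under the projection [Q h],
    which costs [Lx * h] as [J(nu_k)] is [Lx]-Lipschitz ([quantization]), and
    the regret bound applies to [w].  Averaging over [k] concludes; projecting
    inside [<J(nu_k), .>] rather than inside [J(eta)] keeps the error within
    [Lx * h]. *)

(** * Kullback-Leibler estimates on finite types *)

Lemma ln_le_subr1 (R : realType) (t : R) : 0 < t -> ln t <= t - 1.
Proof.
by move=> t0; have := @le_ln1Dx R (t - 1); rewrite subrKC; apply; lra.
Qed.

(** Pointwise, with [a ^+ 2 = p i] and [b ^+ 2 = q i], the inequality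
    [ln (b / a) <= b / a - 1] yields
    [p i * (ln (p i) - ln (q i)) >= (a - b) ^+ 2 + (p i - q i)], and the last
    terms sum to zero. *)
Lemma sqr_hellinger_le_kl (R : realType) (I : finType) (p q : I -> R) :
  (forall i, 0 < p i) -> (forall i, 0 < q i) -> \sum_i p i = \sum_i q i ->
  \sum_i (Num.sqrt (p i) - Num.sqrt (q i)) ^+ 2
    <= \sum_i p i * (ln (p i) - ln (q i)).
Proof.
move=> p0 q0 pq.
rewrite -[leLHS](_ : \sum_i ((Num.sqrt (p i) - Num.sqrt (q i)) ^+ 2
    + (p i - q i)) = _); last first.
  by rewrite big_split/= sumrB pq subrr addr0.
apply: ler_sum => i _.
have [a0 b0] : 0 < Num.sqrt (p i) /\ 0 < Num.sqrt (q i) by rewrite !sqrtr_gt0.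
have := sqr_sqrtr (ltW (p0 i)); have := sqr_sqrtr (ltW (q0 i)).
move: a0 b0; set a := Num.sqrt (p i); set b := Num.sqrt (q i) => a0 b0 <- <-.
rewrite !lnXn// -mulrnBl -[_ *+ 2]mulr_natl.
have ab : ln b - ln a <= b / a - 1.
  by rewrite -ln_div ?posrE// ln_le_subr1// divr_gt0.
have : a ^+ 2 * (ln b - ln a) <= a ^+ 2 * (b / a - 1).
  by rewrite ler_wpM2l// sqr_ge0.
have -> : a ^+ 2 * (b / a - 1) = a * b - a ^+ 2 by field; lra.
nra.
Qed.

(** Pinsker's inequality with constant 4 in place of 2. Factoring
    [p - q = (sqrt p - sqrt q) (sqrt p + sqrt q)] and applying Cauchy-Schwarz
    bounds the square of the l1 distance by 4 times the squared Hellinger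
    distance. *)
Lemma sqr_l1_le_kl (R : realType) (I : finType) (p q : I -> R) :
  (forall i, 0 < p i) -> (forall i, 0 < q i) ->
  \sum_i p i = 1 -> \sum_i q i = 1 ->
  (\sum_i `|p i - q i|) ^+ 2 <= 4 * \sum_i p i * (ln (p i) - ln (q i)).
Proof.
move=> p0 q0 p1 q1.
apply: le_trans (_ : 4 * \sum_i (Num.sqrt (p i) - Num.sqrt (q i)) ^+ 2 <= _).
  set h := \sum_i _ ^+ 2; set l := \sum_i _.
  have l0 : 0 <= l by apply: sumr_ge0.
  (* Cauchy-Schwarz in the form of Young's inequality with a free parameter,
     used at t = 4 / l so that h need not be invertible *)
  have young t : 2 * t * l <= t ^+ 2 * h + 4.
    have -> : 4 = \sum_i (2 * p i + 2 * q i) :> R.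
      by rewrite big_split/= -!mulr_sumr p1 q1; ring.
    rewrite !mulr_sumr -big_split/=; apply: ler_sum => i _.
    have := sqr_sqrtr (ltW (p0 i)); have := sqr_sqrtr (ltW (q0 i)).
    have : 0 <= Num.sqrt (p i) + Num.sqrt (q i) by rewrite addr_ge0.
    set a := Num.sqrt (p i); set b := Num.sqrt (q i) => ab0 <- <-.
    rewrite subr_sqr normrM (ger0_norm ab0).
    rewrite -[(a - b) ^+ 2]real_normK ?num_real//.
    have := sqr_ge0 (t * `|a - b| - (a + b)); have := sqr_ge0 (a - b); nra.
  have [l00|lpos] := eqVneq l 0.
    by rewrite l00 expr0n/= mulr_ge0// sumr_ge0// => i _; rewrite sqr_ge0.
  have {l0} lpos : 0 < l by rewrite lt_neqAle eq_sym lpos.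
  have := young (4 / l).
  have -> : 2 * (4 / l) * l = 8 by field; lra.
  have -> : (4 / l) ^+ 2 * h = 16 * h / l ^+ 2 by field; lra.
  move=> H; have : 4 * l ^+ 2 <= 16 * h / l ^+ 2 * l ^+ 2.
    by rewrite ler_wpM2r ?sqr_ge0//; lra.
  rewrite divfK ?expf_neq0 ?gt_eqF//; lra.
by rewrite ler_pM2l// sqr_hellinger_le_kl// p1 q1.
Qed.

(** One extragradient step: [q] is the half step driven by [a], [r] the full
    step from the same [p] driven by [b]. The normalising constants [Z1] and
    [Z2] drop out because [q], [r] and [w] have the same mass; what remains is
    an identity with two negative divergences, which pay for evaluating the
    gradient at [q] instead of [r]. *)
Lemma mirror_prox_descent (R : realType) (I : finType) (p q r a b w : I -> R)
    (lambda c Z1 Z2 : R) :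
  (forall i, 0 < p i) -> \sum_i p i = 1 ->
  \sum_i q i = 1 -> \sum_i r i = 1 -> \sum_i w i = 1 ->
  0 < Z1 -> 0 < Z2 ->
  (forall i, q i = expR (- lambda * a i) * p i / Z1) ->
  (forall i, r i = expR (- lambda * b i) * p i / Z2) ->
  0 <= lambda -> lambda * c <= 1 / 2 ->
  (forall i, `|b i - a i| <= c * \sum_j `|q j - p j|) ->
  lambda * \sum_i b i * (q i - w i) <= \sum_i w i * (ln (r i) - ln (p i)).
Proof.
move=> p0 p1 q1 r1 w1 Z10 Z20 qE rE lam0 lamc Lip.
have q0 i : 0 < q i by rewrite qE divr_gt0 ?mulr_gt0 ?expR_gt0.
have r0 i : 0 < r i by rewrite rE divr_gt0 ?mulr_gt0 ?expR_gt0.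
have lnE (s v : I -> R) Z : 0 < Z ->
    (forall i, s i = expR (- lambda * v i) * p i / Z) ->
    forall i, lambda * v i = ln (p i) - ln (s i) - ln Z.
  move=> Z0 sE i; rewrite sE ln_div ?posrE ?mulr_gt0 ?expR_gt0//.
  by rewrite lnM ?posrE ?expR_gt0// expRK; ring.
have klqp := sqr_l1_le_kl q0 p0 q1 p1.
have klrq := sqr_l1_le_kl r0 q0 r1 q1.
set kqp := \sum_i q i * _ in klqp; set krq := \sum_i r i * _ in klrq.
set lqp := \sum_j `|q j - p j| in Lip klqp.
set lrq := \sum_j `|r j - q j| in klrq.
have cross : lambda * \sum_i (b i - a i) * (q i - r i) <= kqp + krq.
  apply: (@le_trans _ _ (lambda * \sum_i (c * lqp) * `|r i - q i|)).
    rewrite ler_wpM2l//; apply: ler_sum => i _.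
    rewrite (le_trans (ler_norm _))// normrM [`|q i - _|]distrC.
    by rewrite ler_wpM2r.
  rewrite -mulr_sumr -/lrq.
  have lqp0 : 0 <= lqp by apply: sumr_ge0.
  have lrq0 : 0 <= lrq by apply: sumr_ge0.
  have : lambda * c * (lqp * lrq) <= 1 / 2 * (lqp * lrq).
    by rewrite ler_wpM2r// mulr_ge0.
  have := sqr_ge0 (lqp - lrq); nra.
have -> : lambda * \sum_i b i * (q i - w i) =
    lambda * (\sum_i (b i - a i) * (q i - r i))
    + (\sum_i w i * (ln (r i) - ln (p i)) - kqp - krq)
    - ln Z1 * (\sum_i q i - \sum_i r i) - ln Z2 * (\sum_i r i - \sum_i w i).
  rewrite /kqp /krq -!sumrB !mulr_sumr -big_split/= -!sumrB.
  apply: eq_bigr => i _.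
  have Ea := lnE _ _ _ Z10 qE i; have Eb := lnE _ _ _ Z20 rE i.
  have -> : lambda * (b i * (q i - w i)) = lambda * ((b i - a i) * (q i - r i))
     + (lambda * a i) * (q i - r i) + (lambda * b i) * (r i - w i) by ring.
  by rewrite Ea Eb; ring.
rewrite q1 r1 w1 subrr !mulr0; lra.
Qed.

(** * Borel sets, compactness and the Euclidean distance *)

Lemma borel_open_measurable (R : realType) (d : nat) (U : set 'rV[R]_d) :
  open U -> measurable (U : set (borel_rV R d)).
Proof. by move=> oU; exact: sub_sigma_algebra. Qed.

Lemma borel_closed_measurable (R : realType) (d : nat) (C : set 'rV[R]_d) :
  closed C -> measurable (C : set (borel_rV R d)).
Proof.
by move=> /closed_openC /borel_open_measurable/measurableC; rewrite setCK.
Qed.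

Lemma borel_compact_measurable (R : realType) (d : nat) (C : set 'rV[R]_d) :
  compact C -> measurable (C : set (borel_rV R d)).
Proof.
move=> cC; apply: borel_closed_measurable.
by apply: (@compact_closed 'rV[R]_d) => //; exact: (@norm_hausdorff R 'rV[R]_d).
Qed.

Lemma borel_set1_measurable (R : realType) (d : nat) (x : borel_rV R d) :
  measurable [set x].
Proof. by apply: borel_compact_measurable; exact: compact_set1. Qed.

Lemma borel_range_measurable (R : realType) (d : nat) (I : finType)
    (e : I -> borel_rV R d) : measurable (range e).
Proof.
have -> : range e = \bigcup_i [set e i].
  by apply/seteqP; split=> [_ [i _ <-]|x [i _ ->]]; exists i.
by apply: fin_bigcup_measurable => // i _; exact: borel_set1_measurable.
Qed.

Lemma within_continuous_measurable (R : realType) (d : nat)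
    (D : set 'rV[R]_d) (f : 'rV[R]_d -> R) :
  measurable (D : set (borel_rV R d)) -> {within D, continuous f} ->
  measurable_fun (D : set (borel_rV R d)) f.
Proof.
move=> mD /continuousP cf.
apply: (measurability _ (RGenOpens.measurableE R)) => //.
move=> _ [_ [a [b ->] <-]].
have oI : open (`]a, b[%classic : set R) by exact: interval_open.
have /open_subspaceP [V oV VE] := cf _ oI.
rewrite setIC -VE; apply: measurableI => //; exact: borel_open_measurable.
Qed.

Lemma compact_continuous_integrable (R : realType) (d : nat)
    (Omega : set 'rV[R]_d) (f : 'rV[R]_d -> R)
    (m : {measure set (borel_rV R d) -> \bar R}) :
  compact Omega -> (m Omega < +oo)%E -> {within Omega, continuous f} ->
  m.-integrable Omega (EFin \o f).
Proof.
move=> cO mO cf; apply: measurable_bounded_integrable => //.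
- exact: borel_compact_measurable.
- apply: within_continuous_measurable => //; exact: borel_compact_measurable.
- have /compact_bounded[M [_ mrt]] := continuous_compact cf cO.
  by exists M; split; rewrite ?num_real // => ? ? ? ?; exact: mrt.
Qed.

Lemma coord_le_mx_norm (R : realType) (d : nat) (x : 'rV[R]_d) (i : 'I_d) :
  `|x 0 i| <= `|x|.
Proof.
rewrite [leRHS]/Num.norm /= mx_normrE.
exact: (le_bigmax _ (fun ij : 'I_1 * 'I_d => `|x ij.1 ij.2|) (0, i)).
Qed.

(** The supremum defining the diameter is an upper bound only for a set of
    distances which is bounded; compactness provides this. *)
Lemma compact_eucl_dist_le_diameter (R : realType) (d : nat)
    (Omega : set 'rV[R]_d) (x y : 'rV[R]_d) :
  compact Omega -> Omega x -> Omega y -> eucl_dist x y <= diameter Omega.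
Proof.
move=> /compact_bounded[M0 [_ /(_ (M0 + 1))]].
rewrite ltrDl ltr01 => /(_ isT); set M := M0 + 1 => OM Ox Oy.
apply: ub_le_sup; last by exists (x, y).
exists (Num.sqrt (\sum_(i < d) (2 * M) ^+ 2)) => _ [[u v]] [/= Ou Ov] <-.
rewrite ler_wsqrtr//; apply: ler_sum => i _.
rewrite -[leLHS]real_normK ?num_real// lerXn2r ?nnegrE//.
  by rewrite mulr_ge0// (le_trans (normr_ge0 u))// OM.
rewrite (le_trans (ler_normB _ _))// mulr_natl mulr2n.
by rewrite lerD// (le_trans (coord_le_mx_norm _ _))// OM.
Qed.

Lemma measurable_eucl_dist (R : realType) (d : nat) :
  measurable_fun setT
    (fun z : borel_rV R d * borel_rV R d => eucl_dist z.1 z.2).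
Proof.
have mc i : measurable_fun setT (fun x : borel_rV R d => (x : 'rV[R]_d) 0 i).
  apply: within_continuous_measurable => //.
  by apply: continuous_subspaceT; exact: coord_continuous.
have ms : measurable_fun setT (@Num.sqrt R).
  by apply: continuous_measurable_fun; exact: sqrt_continuous.
apply: (measurableT_comp ms).
apply: measurable_sum => i; apply: measurable_funX; apply: measurable_funB.
  exact: (measurableT_comp (mc i) measurable_fst).
exact: (measurableT_comp (mc i) measurable_snd).
Qed.

(** * Integrals against finitely supported measures *)

Lemma Rintegral_bigcup_fin (d : measure_display) (T : measurableType d)
    (R : realType) (m : {measure set T -> \bar R}) (I : finType)
    (D : set T) (F : I -> set T) (f : T -> R) :
  (forall i, measurable (F i)) -> trivIset setT F -> D = \bigcup_i F i ->
  m.-integrable D (EFin \o f) ->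
  \int[m]_(x in D) f x = \sum_i \int[m]_(x in F i) f x.
Proof.
move=> mF tF DE intf.
have DU : D = \big[setU/set0]_(i <- index_enum I) F i.
  rewrite DE -bigcup_seq; apply: eq_bigcupl.
  by split=> i // _ /=; rewrite mem_index_enum.
have mD : measurable D by rewrite DU; exact: bigsetU_measurable.
rewrite /Rintegral {1}DU integral_bigsetU_EFin ?index_enum_uniq//.
- rewrite sum_fine// => i _; apply: integrable_fin_num => //.
  by apply: (integrableS mD) => //; rewrite DE; exact: bigcup_sup.
- exact: sub_trivIset tF.
- by rewrite -DU; exact: (measurable_int m).
Qed.

(** Stated for general measures: it serves the iterates and their average, which
    is not packaged as a probability. *)
Lemma Rintegral_atoms (R : realType) (d : nat) (I : finType)
    (m : {measure set (borel_rV R d) -> \bar R}) (D : set (borel_rV R d))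
    (e : I -> borel_rV R d) (f : borel_rV R d -> R) :
  injective e -> range e `<=` D -> measurable D ->
  m (D `\` range e) = 0%E -> m.-integrable D (EFin \o f) ->
  \int[m]_(x in D) f x = \sum_i f (e i) * fine (m [set e i]).
Proof.
move=> inje eD mD mDe intf.
have rE : range e = \bigcup_i [set e i].
  by apply/seteqP; split=> [_ [i _ <-]|x [i _ ->]]; exists i.
have me := borel_range_measurable e.
have mDe' : measurable (D `\` range e) by exact: measurableD.
rewrite /Rintegral (negligible_integral mDe')//.
rewrite setDD setIC (setIidl eD) -/(Rintegral m (range e) f).
rewrite (@Rintegral_bigcup_fin _ _ _ _ _ _ (fun i => [set e i]))//.
- apply: eq_bigr => i _.
  rewrite -Rintegral_cst; last exact: borel_set1_measurable.
  by apply: eq_Rintegral => x; rewrite inE => ->.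
- by move=> i; exact: borel_set1_measurable.
- by move=> i j _ _ [x [/= -> /inje]].
- exact: (integrableS mD).
Qed.

Section probability_atoms.
Variables (R : realType) (d : nat) (I : finType).
Variables (mu : probability (borel_rV R d) R) (e : I -> borel_rV R d).
Hypotheses (inje : injective e) (mue : mu (range e) = 1%E).

Lemma atoms_setD_eq0 (D : set (borel_rV R d)) :
  measurable D -> mu (D `\` range e) = 0%E.
Proof.
move=> mD; have me := borel_range_measurable e.
apply/eqP; rewrite eq_le measure_ge0 andbT.
apply: (@le_trans _ _ (mu (~` range e))).
  by apply: le_measure; rewrite ?inE//; [exact: measurableD|exact: measurableC].
by rewrite probability_setC// mue subee.
Qed.

Lemma probability_atoms (A : set (borel_rV R d)) : measurable A ->
  mu A = (\sum_i fine (mu [set e i]) * \1_A (e i))%:E.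
Proof.
move=> mA; have iA : mu.-integrable setT (EFin \o \1_A).
  exact: integrable_indic.
have := Rintegral_atoms inje (@subsetT _ _) measurableT
  (atoms_setD_eq0 measurableT) iA.
rewrite /Rintegral integral_indic// setIT => E.
rewrite -[LHS]fineK ?fin_num_measure// E; congr (_%:E).
by apply: eq_bigr => i _; rewrite mulrC.
Qed.

Lemma sum_atoms : \sum_i fine (mu [set e i]) = 1.
Proof.
apply: EFin_inj; rewrite -(probability_setT mu) (probability_atoms measurableT).
by congr (_%:E); apply: eq_bigr => i _; rewrite indicT mulr1.
Qed.

Lemma atoms_exists : exists i : I, True.
Proof.
have : \sum_i fine (mu [set e i]) != 0 by rewrite sum_atoms oner_neq0.
by apply: contraNP => /forallNP I0; rewrite big1// => i _; case: (I0 i).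
Qed.

End probability_atoms.

(** * Wasserstein distance of finitely supported measures *)

Lemma eucl_dist_ge0 (R : realType) (d : nat) (x y : 'rV[R]_d) :
  0 <= eucl_dist x y.
Proof. exact: sqrtr_ge0. Qed.

Lemma eucl_distxx (R : realType) (d : nat) (x : 'rV[R]_d) : eucl_dist x x = 0.
Proof. by rewrite /eucl_dist big1 ?sqrtr0// => i _; rewrite subrr expr0n. Qed.

(** The maximal coupling of two weight vectors leaves the common part
    [c = min (p, q)] on the diagonal and couples the two excesses [p - c] and
    [q - c], both of mass [t], independently. When [t = 0] the excesses vanish
    and so does the second term, whatever the value of [t^-1]. Since only mass
    [t] is moved, the transport cost is at most [t] times the diameter, and [t]
    is half of the l1 distance. *)
Section maximal_coupling.
Variables (R : realType) (n : nat) (p q : nat -> R).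
Hypotheses (p_ge0 : forall k, 0 <= p k) (q_ge0 : forall k, 0 <= q k).
Hypotheses (p_sum1 : \sum_(k < n) p k = 1) (q_sum1 : \sum_(k < n) q k = 1).

Let c k := Num.min (p k) (q k).
Let t := 1 - \sum_(k < n) c k.

Definition max_coupling_weight k l : R :=
  (if k == l then c k else 0) + (p k - c k) * (q l - c l) / t.

Let cp k : c k <= p k. Proof. by rewrite /c ge_min lexx. Qed.
Let cq k : c k <= q k. Proof. by rewrite /c ge_min lexx orbT. Qed.

Let t_ge0 : 0 <= t.
Proof. by rewrite subr_ge0 -p_sum1; apply: ler_sum => k _; exact: cp. Qed.

Let p_sub_c : \sum_(k < n) (p k - c k) = t. Proof. by rewrite sumrB p_sum1. Qed.
Let q_sub_c : \sum_(k < n) (q k - c k) = t. Proof. by rewrite sumrB q_sum1. Qed.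

Lemma max_coupling_weight_ge0 k l : 0 <= max_coupling_weight k l.
Proof.
rewrite addr_ge0//.
  by case: ifP => // _; rewrite le_min p_ge0 q_ge0.
by rewrite divr_ge0// mulr_ge0// subr_ge0.
Qed.

Let excess_mulVt (s : nat -> R) (k : 'I_n) : (forall k, 0 <= s k) ->
  \sum_(k < n) s k = t -> s k * (t / t) = s k.
Proof.
move=> s0 st; have [t0|t0] := eqVneq t 0; last by rewrite divff// mulr1.
suff -> : s k = 0 by rewrite mul0r.
by move/eqP : st; rewrite t0 psumr_eq0// => /allP/(_ k (mem_index_enum _))/eqP.
Qed.

Lemma max_coupling_weight_suml (k : 'I_n) :
  \sum_(l < n) max_coupling_weight k l = p k.
Proof.
rewrite big_split/= -mulr_suml -mulr_sumr q_sub_c -mulrA.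
rewrite (excess_mulVt (s := fun k => p k - c k))//; last first.
  by move=> j; rewrite subr_ge0.
rewrite (bigD1 k)//= eqxx big1 => [|l lk]; last first.
  by rewrite [k == l :> nat]eq_sym -[l == k :> nat]/(l == k) (negbTE lk).
by rewrite addr0 subrKC.
Qed.

Lemma max_coupling_weight_sumr (l : 'I_n) :
  \sum_(k < n) max_coupling_weight k l = q l.
Proof.
rewrite big_split/= -!mulr_suml p_sub_c mulrAC mulrC.
rewrite (excess_mulVt (s := fun k => q k - c k))//; last first.
  by move=> j; rewrite subr_ge0.
rewrite (bigD1 l)//= eqxx big1 => [|k kl]; last first.
  by rewrite -[k == l :> nat]/(k == l) (negbTE kl).
by rewrite addr0 subrKC.
Qed.

Lemma max_coupling_weight_cost (D : R) (dist : nat -> nat -> R) :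
  (forall k, dist k k = 0) -> (forall k l : 'I_n, dist k l <= D) ->
  \sum_(k < n) \sum_(l < n) max_coupling_weight k l * dist k l
    <= D * (1 / 2 * \sum_(k < n) `|p k - q k|).
Proof.
move=> dist0 distD.
have -> : 1 / 2 * \sum_(k < n) `|p k - q k| = t.
  have -> : t = 1 / 2 * (t + t) by field.
  rewrite -{1}p_sub_c -q_sub_c -big_split/=; congr (_ * _).
  apply: eq_bigr => k _; rewrite /c.
  by case: (leP (p k) (q k)) => pq;
    [rewrite ler0_norm ?subr_le0|rewrite gtr0_norm ?subr_gt0] => //; ring.
apply: (@le_trans _ _
    (\sum_(k < n) \sum_(l < n) D * ((p k - c k) * (q l - c l) / t))).
  apply: ler_sum => k _; apply: ler_sum => l _.
  rewrite mulrDl [X in X + _](_ : _ = 0) ?add0r; last first.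
    by case: ifP => [/eqP ->|_]; rewrite ?dist0 ?mulr0 ?mul0r.
  by rewrite mulrC ler_wpM2r// divr_ge0// mulr_ge0// subr_ge0.
under eq_bigr do rewrite -mulr_sumr -mulr_suml -mulr_sumr q_sub_c.
rewrite -mulr_sumr -!mulr_suml p_sub_c.
by have [->|t0] := eqVneq t 0; rewrite ?mul0r// mulfK.
Qed.

End maximal_coupling.

(** The atoms are indexed by [nat] and not by ['I_n] because the coupling is
    assembled with [msum], which takes a sequence of measures. *)
Lemma W1_le_diam_l1 (R : realType) (d n : nat)
    (mu nu : probability (borel_rV R d) R) (e : nat -> borel_rV R d) (D : R) :
  let p k := fine (mu [set e k]) in
  let q k := fine (nu [set e k]) in
  injective (fun k : 'I_n => e k) ->
  mu (range (fun k : 'I_n => e k)) = 1%E ->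
  nu (range (fun k : 'I_n => e k)) = 1%E ->
  (forall k l : 'I_n, eucl_dist (e k) (e l) <= D) ->
  (W1 mu nu <= (D * (1 / 2 * \sum_(k < n) `|p k - q k|))%:E)%E.
Proof.
move=> p q inje mue nue distD.
have p0 k : 0 <= p k by rewrite fine_ge0.
have q0 k : 0 <= q k by rewrite fine_ge0.
have p1 : \sum_(k < n) p k = 1 by exact: (sum_atoms inje mue).
have q1 : \sum_(k < n) q k = 1 by exact: (sum_atoms inje nue).
pose w k l := NngNum (max_coupling_weight_ge0 p0 q0 p1 k l).
pose m k l : {measure set (borel_rV R d * borel_rV R d) -> \bar R} :=
  mscale (w k l) (dirac (e k, e l)).
pose pi0 : {measure set (borel_rV R d * borel_rV R d) -> \bar R} :=
  msum (fun k => msum (m k) n) n.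
have pi0E A : pi0 A = (\sum_(k < n) \sum_(l < n)
    max_coupling_weight n p q k l * \1_A (e k, e l))%:E.
  rewrite /pi0/= /msum -sumEFin; apply: eq_bigr => k _.
  by rewrite -sumEFin; apply: eq_bigr => l _; rewrite EFinM.
have pi0T : pi0 setT = 1%E.
  rewrite pi0E; congr (_%:E); rewrite -[RHS]p1; apply: eq_bigr => k _.
  rewrite -(max_coupling_weight_suml p1 q1).
  by apply: eq_bigr => l _; rewrite indicT mulr1.
pose pi : probability (borel_rV R d * borel_rV R d)%type R :=
  HB.pack_for (probability (borel_rV R d * borel_rV R d)%type R)
    (Measure.sort pi0)
    (Measure_isProbability.Build _ _ _ pi0 pi0T).
have cpi : coupling mu nu pi.
  move=> A mA; split; rewrite [LHS]pi0E.
  - rewrite (probability_atoms inje mue mA); congr (_%:E).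
    apply: eq_bigr => k _.
    rewrite -/(p k) -(max_coupling_weight_suml p1 q1) mulr_suml.
    by apply: eq_bigr => l _.
  - rewrite (probability_atoms inje nue mA); congr (_%:E).
    rewrite exchange_big/=; apply: eq_bigr => l _.
    rewrite -/(q l) -(max_coupling_weight_sumr p1 q1) mulr_suml.
    by apply: eq_bigr => k _.
apply: (@le_trans _ _ (\int[pi]_z (eucl_dist z.1 z.2)%:E)%E).
  by apply: ereal_inf_lbound; exists pi.
have mdist : measurable_fun setT
    (fun z : borel_rV R d * borel_rV R d => (eucl_dist z.1 z.2)%:E).
  by apply/measurable_EFinP; exact: measurable_eucl_dist.
have dist0 (z : borel_rV R d * borel_rV R d) :
  setT z -> (0 <= (eucl_dist z.1 z.2)%:E)%E.
  by move=> _; rewrite lee_fin eucl_dist_ge0.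
rewrite [leLHS](_ : _ = (\sum_(k < n) \sum_(l < n)
    max_coupling_weight n p q k l * eucl_dist (e k) (e l))%:E); last first.
  rewrite [LHS]ge0_integral_measure_sum// -sumEFin; apply: eq_bigr => k _.
  rewrite ge0_integral_measure_sum// -sumEFin; apply: eq_bigr => l _.
  rewrite ge0_integral_mscale// integral_dirac// diracT mul1e.
  by rewrite EFinM.
rewrite lee_fin.
apply: (max_coupling_weight_cost p1 q1
  (dist := fun k l => eucl_dist (e k) (e l))) => // k.
exact: eucl_distxx.
Qed.

(** * Gibbs steps, quantization and averages *)

(** The Gibbs update read on the atoms. It multiplies each weight by a positive
    factor, so that it preserves the support. *)
Lemma gibbs_step_atoms (R : realType) (d : nat) (I : finType)
    (Omega : set 'rV[R]_d) (lambda : R) (V : 'rV[R]_d -> R)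
    (mu nu : probability (borel_rV R d) R) (e : I -> borel_rV R d) :
  compact Omega -> {within Omega, continuous V} ->
  injective e -> range e `<=` Omega -> mu (range e) = 1%E ->
  (forall i, 0 < fine (mu [set e i])) ->
  gibbs_step Omega lambda V mu nu ->
  nu (range e) = 1%E /\
  exists2 Z, 0 < Z &
    forall i, fine (nu [set e i])
      = expR (- lambda * V (e i)) * fine (mu [set e i]) / Z.
Proof.
move=> cO cV inje eO mue mu0 gibbs.
have mO := borel_compact_measurable cO.
pose g x := expR (- lambda * V x).
have cg : {within Omega, continuous g}.
  move=> x; apply: continuous_comp; last exact: continuous_expR.
  by apply: cvgMl_tmp; exact: cV.
have ig : mu.-integrable Omega (EFin \o g).
  apply: compact_continuous_integrable => //.
  by rewrite ltey_eq fin_num_measure.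
have me := borel_range_measurable e.
have gE D : range e `<=` D -> measurable D -> D `<=` Omega ->
    \int[mu]_(x in D) g x = \sum_i g (e i) * fine (mu [set e i]).
  move=> eD mD DO; apply: Rintegral_atoms => //; first exact: atoms_setD_eq0.
  exact: (integrableS mO).
pose Z := \sum_i g (e i) * fine (mu [set e i]).
have Z0 : 0 < Z.
  have [i _] := atoms_exists inje mue.
  rewrite /Z (bigD1 i)//= ltr_wpDr ?mulr_gt0 ?expR_gt0//.
  by apply: sumr_ge0 => j _; rewrite mulr_ge0 ?expR_ge0// fine_ge0.
split.
  rewrite (gibbs _ me) -/g (setIidl eO) !gE// divff// gt_eqF//.
exists Z => // i.
rewrite (gibbs _ (borel_set1_measurable _)).
have eiO : [set e i] `<=` Omega by move=> _ ->; apply: eO; exists i.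
rewrite (setIidl eiO) /= -/g (gE Omega) // -/Z; congr (_ / _).
rewrite -Rintegral_cst; last exact: borel_set1_measurable.
by apply: eq_Rintegral => x; rewrite inE => ->.
Qed.

(** The weights [w] are those of the image of [eta] under [Q]: each cell
    [Q @^-1` [set e i]] is collapsed to its representative [e i], which changes
    the integral of [f] by at most the oscillation of [f] along [Q]. *)
Lemma quantization (R : realType) (d : nat) (I : finType)
    (Omega : set (borel_rV R d)) (eta : probability (borel_rV R d) R)
    (e : I -> borel_rV R d) (Q : borel_rV R d -> borel_rV R d) :
  measurable Omega -> eta Omega = 1%E -> injective e ->
  measurable_fun Omega Q -> (forall x, Omega x -> range e (Q x)) ->
  exists w : I -> R, [/\ forall i, 0 <= w i, \sum_i w i = 1 &
  forall (f : borel_rV R d -> R) (eps : R),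
    eta.-integrable Omega (EFin \o f) ->
    (forall x, Omega x -> f (Q x) <= f x + eps) ->
    \sum_i f (e i) * w i <= \int[eta]_(x in Omega) f x + eps].
Proof.
move=> mO etaO inje mQ Qe.
pose F i := Omega `&` Q @^-1` [set e i].
have mF i : measurable (F i) by apply: mQ => //; exact: borel_set1_measurable.
have tF : trivIset setT F.
  by move=> i j _ _ [x [[_ /= Qi] [_ /= Qj]]]; apply: inje; rewrite -Qi.
have OE : Omega = \bigcup_i F i.
  apply/seteqP; split=> [x Ox|x [i _ []]//].
  by have [i _ ei] := Qe x Ox; exists i.
have icst (r : R) A : measurable A -> eta.-integrable A (EFin \o cst r).
  exact: finite_measure_integrable_cst.
pose w i := fine (eta (F i)).
have w1 : \sum_i w i = 1.
  have := Rintegral_bigcup_fin mF tF OE (icst 1 _ mO).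
  rewrite Rintegral_cst// [X in fine X]etaO mulr1 => ->.
  by apply: eq_bigr => i _; rewrite Rintegral_cst// mul1r.
exists w; split=> [i|//|f eps intf Qf]; first by rewrite fine_ge0.
rewrite (Rintegral_bigcup_fin mF tF OE intf) -[eps]mul1r -w1 mulr_suml.
rewrite -big_split/=; apply: ler_sum => i _.
have -> : f (e i) * w i = \int[eta]_(x in F i) (f (e i) - eps) + w i * eps.
  by rewrite Rintegral_cst// -/(w i); ring.
rewrite lerD2r; apply: le_Rintegral => //.
- exact: (icst _ _ (mF i)).
- by apply: (integrableS mO) => //; exact: subIsetl.
- by move=> x [Ox /= <-]; rewrite lerBlDr Qf.
Qed.

(** Positivity of the infimum is where finiteness of the index type enters. It
    makes [ln] monotone on the weights: [ln] vanishes at nonpositive numbers. *)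
Lemma min_mass_gt0_le (R : realType) (d : nat) (I : finType)
    (mu : probability (borel_rV R d) R) (e : I -> borel_rV R d) (i0 : I) :
  (forall i, 0 < fine (mu [set e i])) ->
  0 < min_mass (range e) mu /\
  forall i, min_mass (range e) mu <= fine (mu [set e i]).
Proof.
move=> mu0; split; last first.
  move=> i; apply: ge_inf; last by exists (e i) => //; exists i.
  by exists 0 => _ [_ [j _ <-] <-]; exact/ltW.
have [j _ jmin] := @Order.TotalTheory.arg_minP _ _ _ i0 xpredT
  (fun i => fine (mu [set e i])) isT.
apply: (lt_le_trans (mu0 j)); apply: lb_le_inf.
  by exists (fine (mu [set e i0])), (e i0) => //; exists i0.
by move=> _ [_ [k _ <-] <-]; exact: jmin.
Qed.

Lemma average_fin (R : realType) (d : nat)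
    (nu : nat -> probability (borel_rV R d) R) (K : nat)
    (A : set (borel_rV R d)) : measurable A ->
  average nu K A = (K%:R^-1 * \sum_(k < K) fine (nu k A))%:E.
Proof.
move=> mA; rewrite EFinM -sumEFin; congr (_ * _)%E.
by apply: eq_bigr => k _; rewrite fineK ?fin_num_measure.
Qed.

Lemma Rintegral_average (R : realType) (d : nat) (I : finType)
    (nu : nat -> probability (borel_rV R d) R) (K : nat)
    (Omega : set 'rV[R]_d) (f : 'rV[R]_d -> R) (e : I -> borel_rV R d) :
  compact Omega -> {within Omega, continuous f} ->
  injective e -> range e `<=` Omega -> (forall k, nu k (range e) = 1%E) ->
  \int[average nu K]_(x in Omega) f x
    = K%:R^-1 * \sum_(k < K) \int[nu k]_(x in Omega) f x.
Proof.
move=> cO cf inje eO nue; have mO := borel_compact_measurable cO.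
have me := borel_range_measurable e.
have intf (m : {measure set (borel_rV R d) -> \bar R}) :
    (m Omega < +oo)%E -> m.-integrable Omega (EFin \o f).
  by move=> mfin; exact: compact_continuous_integrable.
rewrite (Rintegral_atoms inje eO mO); first last.
- by apply: intf; rewrite average_fin// ltry.
- rewrite average_fin; last exact: measurableD.
  by rewrite big1 ?mulr0// => k _; rewrite (atoms_setD_eq0 (nue k)).
under [in RHS]eq_bigr => k _.
  rewrite (Rintegral_atoms inje eO mO (atoms_setD_eq0 (nue k) mO)); last first.
    by apply: intf; rewrite ltey_eq fin_num_measure.
  over.
rewrite exchange_big/= mulr_sumr; apply: eq_bigr => i _.
rewrite average_fin; last exact: borel_set1_measurable.
by rewrite /= -mulr_sumr mulrCA.
Qed.

(** * Mirror-Prox iterates on a finite set *)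

Lemma prob_on_range (R : realType) (d : nat) (I : finType)
    (Omega : set 'rV[R]_d) (rho : probability (borel_rV R d) R)
    (e : I -> borel_rV R d) :
  measurable (Omega : set (borel_rV R d)) -> range e `<=` Omega ->
  rho (range e) = 1%E -> prob_on Omega rho.
Proof.
move=> mO eO rhoe; apply/eqP; rewrite eq_le probability_le1//= -rhoe.
by apply: le_measure; rewrite ?inE//; exact: borel_range_measurable.
Qed.

Section iterates_on_finite_set.
Variables (R : realType) (d n : nat) (Omega : set 'rV[R]_d).
Variables (J : probability (borel_rV R d) R -> 'rV[R]_d -> R).
Variables (Lm lambda : R) (e : nat -> borel_rV R d).
Variables (mu0 : probability (borel_rV R d) R).
Variables (mu nu : nat -> probability (borel_rV R d) R).
Let X := range (fun i : 'I_n => e i).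
Hypotheses (cO : compact Omega).
Hypotheses (cJ : forall rho, prob_on Omega rho ->
  {within Omega, continuous (J rho)}).
Hypotheses (inje : injective (fun i : 'I_n => e i)) (XO : X `<=` Omega).
Hypotheses (mu0X : mu0 X = 1%E).
Hypotheses (mu0_gt0 : forall i : 'I_n, 0 < fine (mu0 [set e i])).
Hypotheses (iter : KL_mirror_prox Omega J lambda mu0 mu nu).

Let mO : measurable (Omega : set (borel_rV R d)).
Proof. exact: borel_compact_measurable. Qed.

Lemma mirror_prox_support k :
  [/\ mu k X = 1%E, nu k X = 1%E &
      forall i : 'I_n, 0 < fine (mu k [set e i])].
Proof.
have [mu00 step] := iter.
have half j : mu j X = 1%E -> (forall i : 'I_n, 0 < fine (mu j [set e i])) ->
    nu j X = 1%E.
  move=> muX mu_gt0; have [gnu _] := step j.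
  by have [] := gibbs_step_atoms cO (cJ (prob_on_range mO XO muX)) inje XO muX
    mu_gt0 gnu.
suff H : mu k X = 1%E /\ forall i : 'I_n, 0 < fine (mu k [set e i]).
  by case: H => muX mu_gt0; split=> //; exact: half.
elim: k => [|k [muX mu_gt0]]; first by rewrite mu00.
have nuX := half _ muX mu_gt0; have [_ gmu] := step k.
have [mu'X [Z Z0 mu'E]] :=
  gibbs_step_atoms cO (cJ (prob_on_range mO XO nuX)) inje XO muX mu_gt0 gmu.
by split=> // i; rewrite mu'E divr_gt0// mulr_gt0// expR_gt0.
Qed.

Lemma mirror_prox_prob_on k : prob_on Omega (nu k).
Proof.
have [_ nuX _] := mirror_prox_support k; exact: (prob_on_range mO XO).
Qed.

Hypotheses (Lm_gt0 : 0 < Lm).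
Hypotheses (LJ : forall rho sigma, prob_on Omega rho -> prob_on Omega sigma ->
  (sup_norm Omega (fun x => J rho x - J sigma x)%R <=
     Lm%:E * W1 rho sigma)%E).
Hypotheses (lambda_gt0 : 0 < lambda).
Hypotheses (lambdaLD : lambda * (Lm * diameter Omega) <= 1).

(** The potential that telescopes is the sum [u k] of the log-weights of [mu k]
    against [w]: it is nonpositive for every [k], and at [k = 0] it is at
    least [ln (min_mass X mu0)]. *)
Lemma mirror_prox_regret (w : 'I_n -> R) (K : nat) :
  (forall i, 0 <= w i) -> \sum_i w i = 1 ->
  lambda * \sum_(k < K) \sum_(i < n)
      J (nu k) (e i) * (fine (nu k [set e i]) - w i)
    <= ln (1 / min_mass X mu0).
Proof.
move=> w0 w1.
pose u k := \sum_(i < n) w i * ln (fine (mu k [set e i])).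
have [mu00 step] := iter.
have descent k :
    lambda * (\sum_(i < n) J (nu k) (e i) * (fine (nu k [set e i]) - w i))
    <= u k.+1 - u k.
  have [muX nuX mu_gt0] := mirror_prox_support k; have [gnu gmu] := step k.
  have [mu'X _ _] := mirror_prox_support k.+1.
  have muO := prob_on_range mO XO muX; have nuO := prob_on_range mO XO nuX.
  have [_ [Z1 Z10 nuE]] := gibbs_step_atoms cO (cJ muO) inje XO muX mu_gt0 gnu.
  have [_ [Z2 Z20 mu'E]] := gibbs_step_atoms cO (cJ nuO) inje XO muX mu_gt0 gmu.
  rewrite /u -sumrB; under [leRHS]eq_bigr do rewrite -mulrBr.
  apply: (mirror_prox_descent (p := fun i : 'I_n => fine (mu k [set e i]))
    (a := fun i => J (mu k) (e i)) (c := Lm * diameter Omega * (1 / 2)) mu_gt0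
    (sum_atoms inje muX) (sum_atoms inje nuX) (sum_atoms inje mu'X) w1
    Z10 Z20 nuE mu'E (ltW lambda_gt0)).
    by rewrite mulrA ler_piMl.
  move=> i; rewrite -lee_fin.
  apply: (@le_trans _ _ (sup_norm Omega (fun x => J (nu k) x - J (mu k) x))).
    by apply: ereal_sup_ubound; exists (e i) => //; apply: XO; exists i.
  apply: le_trans (LJ nuO muO) _.
  rewrite -(mulrA _ (1 / 2)) -(mulrA Lm) EFinM lee_pmul2l//.
  apply: W1_le_diam_l1 => // j l.
  by apply: compact_eucl_dist_le_diameter => //; apply: XO; [exists j|exists l].
have [i0 _] := atoms_exists inje mu0X.
have [m0 mle] := min_mass_gt0_le i0 mu0_gt0.
rewrite mulr_sumr; apply: (@le_trans _ _ (u K - u 0)).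
  rewrite -(telescope_sumr u (leq0n K)) big_mkord; apply: ler_sum => k _.
  exact: descent.
rewrite div1r lnV ?posrE//.
rewrite /u -sumrB mu00 -[leRHS]mul1r -w1 mulr_suml; apply: ler_sum => i _.
rewrite -mulrBr ler_wpM2l//.
have muK1 : ln (fine (mu K [set e i])) <= 0.
  have mei := borel_set1_measurable (e i).
  by apply: ln_le0; rewrite -lee_fin fineK ?fin_num_measure// probability_le1.
have : ln (min_mass X mu0) <= ln (fine (mu0 [set e i])).
  by rewrite ler_ln ?posrE.
lra.
Qed.

End iterates_on_finite_set.

(** * Convergence of the averaged iterates *)

Theorem theorem3p2 (R : realType) (d : nat) (Omega : set 'rV[R]_d)
  (J : probability (borel_rV R d) R -> 'rV[R]_d -> R) (Lm Lx lambda : R)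
  (X : R -> set 'rV[R]_d) (Q : R -> borel_rV R d -> borel_rV R d)
  (mu0 : R -> probability (borel_rV R d) R)
  (mu nu : R -> nat -> probability (borel_rV R d) R) :
  Omega !=set0 -> compact Omega ->
  (forall rho, prob_on Omega rho -> {within Omega, continuous (J rho)}) ->
  (forall rho sigma, prob_on Omega rho -> prob_on Omega sigma ->
     0 <= pairing_sub Omega (fun x => J rho x - J sigma x) rho sigma) ->
  0 < Lm ->
  (forall rho sigma, prob_on Omega rho -> prob_on Omega sigma ->
     (sup_norm Omega (fun x => J rho x - J sigma x)%R <=
        Lm%:E * W1 rho sigma)%E) ->
  0 < Lx ->
  (forall rho x y, prob_on Omega rho -> Omega x -> Omega y ->
     `|J rho x - J rho y| <= Lx * eucl_dist x y) ->
  (forall h, 0 < h -> finite_set (X h) /\ X h `<=` Omega) ->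
  (forall h, 0 < h ->
     [/\ measurable_fun (Omega : set (borel_rV R d)) (Q h),
         forall x, Omega x -> X h (Q h x) &
         (ereal_sup [set (eucl_dist (Q h x) x)%:E | x in Omega] <= h%:E)%E]) ->
  (forall h, 0 < h ->
     prob_on (X h) (mu0 h) /\
     forall x, X h x -> (0 < mu0 h [set x])%E) ->
  0 < lambda ->
  (* in \bar R, with 0^-1 = +oo when the diameter vanishes *)
  (lambda%:E < ((Lm * diameter Omega)%:E)^-1)%E ->
  (forall h, 0 < h ->
     KL_mirror_prox Omega J lambda (mu0 h) (mu h) (nu h)) ->
  forall (h : R) (K : nat), 0 < h -> (1 <= K)%N ->
  forall eta, prob_on Omega eta ->
    - (ln (1 / min_mass (X h) (mu0 h)) / (lambda * K%:R) + (2 * Lm + Lx) * h)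
      <= pairing_sub Omega (J eta) eta (average (nu h) K).
Proof.
move=> [x0 Ox0] cO cJ mono Lm0 LJ Lx0 LipJ finX QX mu0X lam0 lamD iter.
move=> h K h0 K0 eta etaO.
have mO : measurable (Omega : set (borel_rV R d)).
  exact: borel_compact_measurable.
have [fX XO] := finX h h0; have [mQ QXh Qh] := QX h h0.
have [mu0Xh mu0pos] := mu0X h h0; have {iter} it := iter h h0.
have lamD1 : lambda * (Lm * diameter Omega) <= 1.
  have D0 : 0 <= Lm * diameter Omega.
    rewrite mulr_ge0 ?(ltW Lm0)//.
    apply: le_trans (compact_eucl_dist_le_diameter cO Ox0 Ox0).
    exact: eucl_dist_ge0.
  move: lamD; rewrite inver; case: eqVneq => [->|D1]; first by rewrite mulr0.
  rewrite lte_fin => /ltW; rewrite -[X in _ <= X]div1r ler_pdivlMr//.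
  by rewrite lt_neqAle eq_sym D1.
have [s us sX] : exists2 s : seq 'rV[R]_d, uniq s & X h = [set` s].
  have /finite_seqP[s sX] := fX; exists (undup s); first exact: undup_uniq.
  by rewrite sX; apply/seteqP; split=> x /=; rewrite mem_undup.
pose n := size s; pose e k : borel_rV R d := nth x0 s k.
have inje : injective (fun i : 'I_n => e i).
  by move=> i j /eqP; rewrite /e nth_uniq// => /eqP/val_inj.
have Xe : X h = range (fun i : 'I_n => e i).
  rewrite sX; apply/seteqP; split=> [x /= xs|_ [i _ <-]]; last exact: mem_nth.
  have ixs : (index x s < n)%N by rewrite index_mem.
  by exists (Ordinal ixs) => //; rewrite /e/= nth_index.
have eO : range (fun i : 'I_n => e i) `<=` Omega by rewrite -Xe.
have mu0e : mu0 h (range (fun i : 'I_n => e i)) = 1%E by rewrite -Xe.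
have mu0_gt0 (i : 'I_n) : 0 < fine (mu0 h [set e i]).
  have mei := borel_set1_measurable (e i).
  rewrite fine_gt0// ltey_eq fin_num_measure// andbT.
  by apply: mu0pos; rewrite Xe; exists i.
have supp k := mirror_prox_support cO cJ inje eO mu0e mu0_gt0 it k.
have nuO k := mirror_prox_prob_on cO cJ inje eO mu0e mu0_gt0 it k.
have intJ (rho sigma : probability (borel_rV R d) R) : prob_on Omega rho ->
    sigma.-integrable Omega (EFin \o J rho).
  move=> rhoO; apply: compact_continuous_integrable; [by []| |exact: cJ].
  by rewrite ltey_eq fin_num_measure.
have QeO x : Omega x -> range (fun i : 'I_n => e i) (Q h x).
  by rewrite -Xe; exact: QXh.
have [w [w0 w1 quant]] := quantization mO etaO inje mQ QeO.
have quantJ k : \sum_(i < n) J (nu h k) (e i) * w i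
    <= \int[eta]_(x in Omega) J (nu h k) x + Lx * h.
  apply: quant; first exact: intJ.
  move=> x Ox; rewrite -lerBlDl (le_trans (ler_norm _))//.
  rewrite (le_trans (LipJ _ _ _ (nuO k) _ Ox))//; first exact/XO/QXh.
  rewrite ler_pM2l// -lee_fin (le_trans _ Qh)//.
  by apply: ereal_sup_ubound; exists x.
have int_nu k (f : borel_rV R d -> R) :
    (nu h k).-integrable Omega (EFin \o f) ->
    \int[nu h k]_(x in Omega) f x
    = \sum_(i < n) f (e i) * fine (nu h k [set e i]).
  have [_ nue _] := supp k; move=> intf.
  by apply: Rintegral_atoms => //; exact: atoms_setD_eq0.
have regret := mirror_prox_regret cO cJ inje eO mu0e mu0_gt0 it Lm0 LJ lam0
  lamD1 K w0 w1.
(* monotonicity moves J from eta to nu_k, where eta can be projected *)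
have step k : \int[nu h k]_(x in Omega) J eta x - \int[eta]_(x in Omega) J eta x
    <= \sum_(i < n) J (nu h k) (e i) * (fine (nu h k [set e i]) - w i) + Lx * h.
  have := mono _ _ etaO (nuO k).
  rewrite /pairing_sub !RintegralB//; try exact: intJ.
  rewrite (int_nu _ (J (nu h k))); last exact: intJ.
  have -> : \sum_(i < n) J (nu h k) (e i) * (fine (nu h k [set e i]) - w i)
      = \sum_(i < n) J (nu h k) (e i) * fine (nu h k [set e i])
        - \sum_(i < n) J (nu h k) (e i) * w i.
    by rewrite -sumrB; apply: eq_bigr => i _; rewrite mulrBr.
  have := quantJ k; lra.
have avg : \int[average (nu h) K]_(x in Omega) J eta x
    = K%:R^-1 * \sum_(k < K) \int[nu h k]_(x in Omega) J eta x.
  apply: (Rintegral_average _ cO (cJ _ etaO) inje eO) => k.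
  by have [] := supp k.
rewrite /pairing_sub avg.
have K0' : 0 < K%:R :> R by rewrite ltr0n.
have sumstep : \sum_(k < K) \int[nu h k]_(x in Omega) J eta x
     <= ln (1 / min_mass (X h) (mu0 h)) / lambda
       + K%:R * (\int[eta]_(x in Omega) J eta x + Lx * h).
  have S : \sum_(k < K)
      (\int[nu h k]_(x in Omega) J eta x - \int[eta]_(x in Omega) J eta x)
    <= \sum_(k < K) (\sum_(i < n)
        J (nu h k) (e i) * (fine (nu h k [set e i]) - w i) + Lx * h).
    by apply: ler_sum => k _; exact: step.
  have sum_cst (c : R) : \sum_(k < K) c = K%:R * c.
    by rewrite sumr_const card_ord mulr_natl.
  move: S; rewrite sumrB big_split/= !sum_cst => S.
  have : \sum_(k < K) \sum_(i < n)
        J (nu h k) (e i) * (fine (nu h k [set e i]) - w i)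
      <= ln (1 / min_mass (X h) (mu0 h)) / lambda.
    by rewrite Xe ler_pdivlMr// mulrC.
  lra.
have := ler_wpM2l (ltW (eqbRL (invr_gt0 _) K0')) sumstep.
rewrite mulrDr mulKf ?gt_eqF//.
have : 0 <= Lm * h by rewrite mulr_ge0// ltW.
lra.
Qed.
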